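(* Let $\alpha_1,\alpha_2>0$ and $\lambda\ge 0$ be real numbers, set $\alpha^+=\alpha_1+\alpha_2$, and let $X_1'$ be a random variable with the Type I non-central beta distribution $\mathrm{NcB1}(\alpha_1,\alpha_2,\lambda)$. Then for every integer $r\ge 1$, $$\mathbb{E}\left[(X_1')^r\right]=\frac{(\alpha_1)_r}{(\alpha^+)_r}\; e^{-\frac{\lambda}{2}}\sum_{i=0}^{r}\frac{\binom{r}{i}(\alpha^+)_i\left(\frac{\lambda}{2}\right)^i}{(\alpha_1)_i\,(\alpha^++r)_i}\;{}_1F_1\!\left(\alpha^++i;\,\alpha^++r+i;\,\frac{\lambda}{2}\right).$$ Here the factor $(\alpha_1)_r/(\alpha^+)_r$ is the $r$-th moment about zero of the $\mathrm{Beta}(\alpha_1,\alpha_2)$ distribution.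
   Context: For $a>0$ and an integer $l\ge 0$, $(a)_l=\Gamma(a+l)/\Gamma(a)$ is the Pochhammer symbol (ascending factorial). ${}_1F_1(a;b;x)=\sum_{i=0}^{\infty}\frac{(a)_i}{(b)_i}\frac{x^i}{i!}$ is Kummer's confluent hypergeometric function. The Type I non-central beta distribution $\mathrm{NcB1}(\alpha_1,\alpha_2,\lambda)$ is the distribution on $(0,1)$ with density $\sum_{j=0}^{\infty}e^{-\lambda/2}\frac{(\lambda/2)^j}{j!}\,\mathrm{Beta}(x;\alpha_1+j,\alpha_2)$, where $\mathrm{Beta}(x;p,q)=\frac{x^{p-1}(1-x)^{q-1}}{B(p,q)}$, $0<x<1$, is the beta density. Equivalently, it is the law of $Y_1'/(Y_1'+Y_2)$ with $Y_1'$ and $Y_2$ independent, $Y_1'$ non-central chi-squared with $2\alpha_1$ degrees of freedom and non-centrality parameter $\lambda$ (i.e. chi-squared with $2\alpha_1+2M$ degrees of freedom given $M\sim\mathrm{Poisson}(\lambda/2)$), and $Y_2$ chi-squared with $2\alpha_2$ degrees of freedom. Convention: $0^0=1$. *)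

(* Defs.v *)
From HB Require Import structures.
From mathcomp Require Import all_boot all_order all_algebra.
From mathcomp Require Import all_classical all_reals all_analysis.

Set Implicit Arguments.
Unset Strict Implicit.
Unset Printing Implicit Defensive.

Import Order.TTheory GRing.Theory Num.Theory.
Import numFieldNormedType.Exports.

Local Open Scope classical_set_scope.
Local Open Scope ring_scope.

Definition Gamma (R : realType) (a : R) : R :=
  \int[lebesgue_measure]_(t in `]0, +oo[) (t `^ (a - 1) * expR (- t)).

Definition pochhammer (R : realType) (a : R) (l : nat) : R :=
  Gamma (a + l%:R) / Gamma a.

(* Kummer's function 1F1(a; b; x); it is only used for b > 0, where the series
   converges for every x. *)
Definition kummer (R : realType) (a b x : R) : R :=
  limn (series (fun i : nat =>
    pochhammer a i / pochhammer b i * (x ^+ i / i`!%:R))).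

(* Beta function and Beta density with real parameters; the library's
   [beta_fun] and [beta_pdf] only take natural-number parameters. *)
Definition rbeta_fun (R : realType) (p q : R) : R :=
  \int[lebesgue_measure]_(x in `]0, 1[) (x `^ (p - 1) * (1 - x) `^ (q - 1)).

Definition rbeta_pdf (R : realType) (p q : R) : R -> R :=
  (fun x : R => x `^ (p - 1) * (1 - x) `^ (q - 1) / rbeta_fun p q) \_ `]0, 1[.

(* The series of nonnegative terms is summed in \bar R. It vanishes outside
   ]0, 1[ because [rbeta_pdf] does. *)
Definition ncb1_pdf (R : realType) (a1 a2 lam : R) (x : R) : \bar R :=
  (\sum_(0 <= j <oo)
     (expR (- (lam / 2)) * ((lam / 2) ^+ j / j`!%:R)
      * rbeta_pdf (a1 + j%:R) a2 x)%:E)%E.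

Definition has_pdf (d : measure_display) (T : measurableType d) (R : realType)
    (P : probability T R) (X : {RV P >-> R}) (f : R -> \bar R) : Prop :=
  forall A : set R, measurable A ->
    distribution P X A = (\int[lebesgue_measure]_(x in A) f x)%E.

(* Main.v *)
Require Import Defs.
From HB Require Import structures.
From mathcomp Require Import all_boot all_order all_algebra.
From mathcomp Require Import all_classical all_reals all_analysis.
From mathcomp Require Import measurable_realfun ring lra.

Import Order.TTheory GRing.Theory Num.Theory.
Import numFieldNormedType.Exports.

Local Open Scope classical_set_scope.
Local Open Scope ring_scope.

(** The density of NcB1(a1, a2, lam) is a Poisson(z) mixture, z = lam / 2, of
    the densities Beta(a1 + j, a2), so its r-th moment is the same mixture of
    their r-th moments, which are quotients of beta functions:
    B(a1 + j + r, a2) / B(a1 + j, a2) = (a1 + j)_r / (a1 + a2 + j)_r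
    ([rbeta_moment], [ncb1_moment]).  The rest of the formula is a resummation
    of the series sum_j z^j / j! * (a1 + j)_r / (b + j)_r with b = a1 + a2
    ([cvg_series_rising_ratio]).

    The dependence on j of the numerator is disentangled by the
    Chu-Vandermonde identity
    (a + j)_r = sum_i C(r, i) * j(j-1)...(j-i+1) * (a + i)_(r - i)
    ([rising_Vandermonde]); the falling factorial cancels against j!, shifting
    the series by i places, and
    (b + j)_r = (b)_r (b + r)_j / (b)_j
    turns what remains into the coefficients (b + i)_k / (b + r + i)_k of a
    Kummer series ([cvg_series_ffact]).

    Two analytic facts feed this algebra.  The Pochhammer symbol is defined by
    Gamma functions, and it equals a product because Gamma(a + 1) = a Gamma(a)
    ([pochhammerE]); the beta function satisfies
    B(p + 1, q) = p / (p + q) B(p, q) ([rbeta_funD1]).  Both recursions are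
    integrations by parts against a primitive that vanishes at both ends of an
    open interval, and both follow from [ge0_integral_derive_sub].  That lemma
    is stated for integrals in the extended reals, so that finiteness can be
    deduced from the recursions instead of being assumed by them.  Finally
    [expectation_pdf] turns an expectation into an integral against the
    density. *)

(** * Rising factorials *)

Definition rising {R : pzSemiRingType} (a : R) (n : nat) : R :=
  \prod_(k < n) (a + k%:R).

Lemma risingS {R : pzSemiRingType} (a : R) n :
  rising a n.+1 = rising a n * (a + n%:R).
Proof. by rewrite /rising big_ord_recr. Qed.

Lemma risingSl {R : pzSemiRingType} (a : R) n :
  rising a n.+1 = a * rising (a + 1) n.
Proof.
rewrite /rising big_ord_recl addr0; congr (_ * _).
by apply: eq_bigr => k _; rewrite /= /bump /= natrD addrA.
Qed.

Lemma risingD {R : pzSemiRingType} (a : R) m n :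
  rising a (m + n) = rising a m * rising (a + m%:R) n.
Proof.
rewrite /rising big_split_ord /=; congr (_ * _).
by apply: eq_bigr => k _; rewrite natrD addrA.
Qed.

Lemma rising_gt0 {R : numDomainType} (a : R) n : 0 < a -> 0 < rising a n.
Proof. by move=> a0; apply: prodr_gt0 => k _; rewrite ltr_wpDr. Qed.

(** The Chu-Vandermonde identity, which expands the Pochhammer symbol of a + j
    in falling factorials of j.  By induction on r: in
    (a + j)_(r+1) = (a + j) (a + 1 + j)_r, write the factor a + j as
    (a + i) + (j - i) in the i-th term; the first part extends the rising
    factorial to the left, the second extends the falling one, and the two sums
    recombine by Pascal's rule. *)
Lemma rising_Vandermonde {R : comPzRingType} (a : R) (j r : nat) :
  rising (a + j%:R) r =
  \sum_(0 <= i < r.+1) ('C(r, i) * j ^_ i)%:R * rising (a + i%:R) (r - i).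
Proof.
elim: r a => [|r IHr] a.
  by rewrite big_nat1 bin0 ffactn0 subnn /rising !big_ord0 mulr1.
rewrite risingSl addrAC IHr big_distrr /=.
have split_term i : (i < r.+1)%N ->
    (a + j%:R) * (('C(r, i) * j ^_ i)%:R * rising (a + 1 + i%:R) (r - i)) =
    ('C(r, i) * j ^_ i)%:R * rising (a + i%:R) (r.+1 - i) +
    ('C(r, i) * j ^_ i.+1)%:R * rising (a + i.+1%:R) (r - i).
  move=> ir; rewrite subSn// risingSl -addrA -(natrD _ 1 i) add1n -[a + i%:R + 1]addrA.
  rewrite natr1 ffactnSr !natrM.
  (* For j < i the subtraction j - i is truncated, but j ^_ i vanishes. *)
  have [ij|ji] := leqP i j; first by rewrite natrB//; ring.
  by rewrite ffact_small//; ring.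
rewrite (eq_big_nat _ _ (fun i ir => split_term i (proj2 (andP ir)))) big_split /=.
have -> : \sum_(0 <= i < r.+1) ('C(r, i) * j ^_ i)%:R * rising (a + i%:R) (r.+1 - i)
  = \sum_(0 <= i < r.+2) ('C(r, i) * j ^_ i)%:R * rising (a + i%:R) (r.+1 - i).
  by rewrite [RHS]big_nat_recr//= bin_small// mul0n mul0r addr0.
rewrite [RHS]big_nat_recl// [X in X + _]big_nat_recl//= -addrA; congr (_ + _).
  by rewrite !bin0.
rewrite -big_split /=; apply: eq_big_nat => i ir.
by rewrite binS mulnDl natrD mulrDl subSS.
Qed.

(** * Integration by parts on open intervals *)

(** Integration by parts on an open interval D, exhausted by the compact
    intervals [al n, be n]: when F' = u - v with u and v nonnegative, the
    integrals of u and v differ by the jump of F between the ends.  The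
    fundamental theorem of calculus gives this on each compact interval, and
    monotone convergence passes to the limit on each side separately, in the
    extended reals. *)
Lemma ge0_integral_derive_sub {R : realType} (al be : R^nat) (D : set R)
    (F u v : R -> R) (c d : R) :
  D = \bigcup_n `[al n, be n]%classic ->
  (forall n, al n < be n) -> nonincreasing_seq al -> nondecreasing_seq be ->
  (forall x, D x -> 0 <= u x) -> (forall x, D x -> 0 <= v x) ->
  (forall x, D x -> {for x, continuous u}) ->
  (forall x, D x -> {for x, continuous v}) ->
  (forall x, D x -> is_derive x 1 F (u x - v x)) ->
  F (al n) @[n --> \oo] --> c -> F (be n) @[n --> \oo] --> d ->
  (\int[lebesgue_measure]_(x in D) (u x)%:E =
   (d - c)%:E + \int[lebesgue_measure]_(x in D) (v x)%:E)%E.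
Proof.
move=> DE albe nial ndbe u0 v0 cu cv dF Fal Fbe.
pose K n := `[al n, be n]%classic.
have KD n : K n `<=` D by rewrite DE; exact: bigcup_sup.
have ndK : nondecreasing_seq K.
  move=> m n mn; rewrite subsetEset; apply: subset_itvScc.
    exact: nial.
  exact: ndbe.
have within_K n (f : R -> R) : (forall x, D x -> {for x, continuous f}) ->
    {within K n, continuous f}.
  move=> cf; apply: continuous_in_subspaceT => x /[!inE] Kx.
  by apply: cf; exact: KD Kx.
have integrable_K n (f : R -> R) : (forall x, D x -> {for x, continuous f}) ->
    lebesgue_measure.-integrable (K n) (EFin \o f).
  move=> cf; apply: continuous_compact_integrable; first exact: segment_compact.
  exact: within_K.
have cvg_K (f : R -> R) : (forall x, D x -> 0 <= f x) ->
    (forall x, D x -> {for x, continuous f}) ->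
    (\int[lebesgue_measure]_(x in K n) (f x)%:E)%E @[n --> \oo] -->
    (\int[lebesgue_measure]_(x in D) (f x)%:E)%E.
  move=> f0 cf; rewrite DE; apply: ge0_nondecreasing_set_cvg_integral => //.
  - by move=> n; exact: measurable_itv.
  - by move=> n; exact: measurable_int (integrable_K n f cf).
  - by move=> n x Kx; rewrite lee_fin; apply: f0; exact: KD Kx.
have FTC n : (\int[lebesgue_measure]_(x in K n) (u x)%:E =
    (F (be n) - F (al n))%:E + \int[lebesgue_measure]_(x in K n) (v x)%:E)%E.
  have iv := integrable_K n v cv.
  rewrite EFinB -(@continuous_FTC2 _ (u \- v) F)//.
  - under [X in (_ = X + _)%E]eq_integral do rewrite /= EFinB.
    rewrite integralB//; last exact: integrable_K.
    by rewrite subeK// integrable_fin_num.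
  - apply: within_K => x Dx; apply: cvgB; [exact: cu|exact: cv].
  - have cF x : D x -> {for x, continuous F}.
      by move=> /dF Fx; apply/differentiable_continuous/derivable1_diffP; exact: ex_derive.
    split.
    + by move=> x xab; have [] := dF x (KD n _ (subset_itv_oo_cc xab)).
    + by apply: cvg_at_right_filter; apply/cF/(KD n); rewrite /K /= in_itv/= lexx ltW.
    + by apply: cvg_at_left_filter; apply/cF/(KD n); rewrite /K /= in_itv/= lexx ltW.
  - move=> x xab; rewrite derive1E.
    by have [_ ->] := dF x (KD n _ (subset_itv_oo_cc xab)).
have := cvg_K u u0 cu; under eq_cvg do rewrite FTC.
move=> /cvg_lim <-//; apply/cvg_lim => //.
apply: cvgeD; last exact: cvg_K.
  by rewrite fin_num_adde_defr.
apply: cvg_EFin; first exact: nearW.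
exact: cvgB.
Qed.

Lemma integral_gt0 {R : realType} (D : set R) (f : R -> R) :
  measurable D -> lebesgue_measure D != 0%E -> measurable_fun D f ->
  (forall x, D x -> 0 < f x) ->
  (0 < \int[lebesgue_measure]_(x in D) (f x)%:E)%E.
Proof.
move=> mD D0 mf f0; rewrite lt0e integral_ge0 ?andbT; last first.
  by move=> x /f0 /ltW; rewrite lee_fin.
apply: contra D0 => /eqP If0; apply/eqP/measure_negligible => //.
have [+ _] := ae_eq_integral_abs lebesgue_measure mD (iffRL (measurable_EFinP D f) mf).
case.
  rewrite -[RHS]If0; apply: eq_integral => x /[!inE] Dx.
  by rewrite gee0_abs// lee_fin ltW// f0.
move=> N [mN N0 DN]; exists N; split => // x Dx; apply: DN => /= /(_ Dx) [] fx0.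
by have := f0 _ Dx; rewrite fx0 ltxx.
Qed.

Lemma cvg_powR0 {R : realType} (u : R^nat) (p : R) : 0 < p ->
  (forall n, 0 < u n) -> u n @[n --> \oo] --> 0 -> u n `^ p @[n --> \oo] --> 0.
Proof.
move=> p0 u0 cu; have [+ _] := cvg_at_rightP (fun a : R => a `^ p) 0 0.
by move=> /(_ (powR_cvg0 p0) u); apply.
Qed.

(** The exponential dominates x^k / k! for every k; an integer k above p + 1
    leaves a factor 1 / x to spare. *)
Lemma cvg_powR_expRN {R : realType} (p : R) :
  (n.+2%:R `^ p * expR (- n.+2%:R)) @[n --> \oo] --> (0 : R).
Proof.
pose m := (Num.truncn p).+1.
have pm : p <= m%:R by rewrite ltW// truncnS_gt.
have cvg0 : (m.+1`!%:R * harmonic n.+1) @[n --> \oo] --> (0 : R).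
  rewrite -[X in _ --> X](mulr0 m.+1`!%:R); apply: cvgMr.
  rewrite cvg_shiftS; exact: cvg_harmonic.
apply: squeeze_cvgr (cvg_cst 0) cvg0; near=> n.
rewrite mulr_ge0 ?powR_ge0 ?expR_ge0//=.
have x1 : 1 <= n.+2%:R :> R by rewrite ler1n.
apply: (@le_trans _ _ (n.+2%:R ^+ m * expR (- n.+2%:R))).
  by rewrite ler_wpM2r ?expR_ge0// -powR_mulrn// ler_powR.
rewrite expRN ler_pdivrMr ?expR_gt0// mulrAC.
rewrite ler_pdivlMr// -exprSr -ler_pdivrMl ?ltr0n ?fact_gt0// mulrC.
apply: le_trans (expR_ge1Dxn m (ltW (lt_le_trans ltr01 x1))).
by rewrite lerDr.
Unshelve. all: by end_near. Qed.

(** The offsets in this exhaustion and the next keep even the first compact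
    interval nondegenerate. *)
Lemma itv0y_bigcup {R : realType} :
  `]0, +oo[%classic = \bigcup_n `[n.+1%:R^-1, n.+2%:R]%classic :> set R.
Proof.
apply/seteqP; split => [x|x [n _]] /=; rewrite !in_itv/= ?andbT => x0; last first.
  by case/andP: x0 => + _; apply: lt_le_trans; rewrite invr_gt0.
have [n []] : exists n : nat, n.+1%:R^-1 < x /\ x <= n%:R.
  apply: (@filter_ex _ \oo); near=> n; split; near: n.
    exact: near_infty_natSinv_lt (PosNum x0).
  exact: nbhs_infty_ger.
move=> xn nx; exists n => //=; rewrite in_itv/= ltW//= (le_trans nx)// ler_nat.
by rewrite -addn2 leq_addr.
Unshelve. all: by end_near. Qed.

Lemma itv01_bigcup {R : realType} :
  `]0, 1[%classic = \bigcup_n `[n.+3%:R^-1, 1 - n.+3%:R^-1]%classic :> set R.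
Proof.
apply/seteqP; split => [x|x [n _]] /=; rewrite !in_itv/= => /andP[x0 x1]; last first.
  have h : 0 < n.+3%:R^-1 :> R by rewrite invr_gt0.
  by rewrite (lt_le_trans h x0)/= (le_lt_trans x1)// ltrBlDr ltrDl.
rewrite -subr_gt0 in x1.
have [n []] : exists n : nat, n.+1%:R^-1 < x /\ n.+1%:R^-1 < 1 - x.
  apply: (@filter_ex _ \oo); near=> n; split; near: n.
    exact: near_infty_natSinv_lt (PosNum x0).
  exact: near_infty_natSinv_lt (PosNum x1).
move=> nx nx1; exists n => //=; rewrite in_itv/=.
have h : n.+3%:R^-1 <= n.+1%:R^-1 :> R.
  by rewrite lef_pV2 ?posrE// ler_nat -addn2 leq_addr.
rewrite (le_trans h (ltW nx))/= lerBrDr -lerBrDl.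
exact: le_trans h (ltW nx1).
Unshelve. all: by end_near. Qed.

(** * The Gamma function and the Pochhammer symbol *)

Lemma continuous_powR_gt0 {R : realType} (p x : R) : 0 < x ->
  {for x, continuous (fun t => t `^ p)}.
Proof.
move=> x0; apply/differentiable_continuous/derivable1_diffP.
by apply: derivable_powR; rewrite in_itv/= x0.
Qed.

Lemma continuous_expRN {R : realType} : continuous (fun t : R => expR (- t)).
Proof.
by move=> x; apply: continuous_comp; [exact: opp_continuous|exact: continuous_expR].
Qed.

Lemma measurable_powR_expRN {R : realType} (D : set R) (p : R) :
  measurable_fun D (fun t : R => t `^ p * expR (- t)).
Proof.
apply: measurable_funTS; apply: measurable_funM; first exact: measurable_powR.
by apply: measurableT_comp => //; exact: measurable_funN.
Qed.

(** The Gamma integral before truncation to a real number: [Gamma] is 0 when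
    the integral diverges, so the functional equation has to be established
    here first. *)
Definition gamma_integral {R : realType} (a : R) : \bar R :=
  \int[lebesgue_measure]_(t in `]0, +oo[) (t `^ (a - 1) * expR (- t))%:E.

Lemma GammaE {R : realType} (a : R) : Gamma a = fine (gamma_integral a).
Proof. by []. Qed.

(** Integration by parts with the primitive t^a e^-t, which vanishes at 0 and
    at infinity. *)
Lemma gamma_integralD1 {R : realType} (a : R) : 0 < a ->
  (a%:E * gamma_integral a = gamma_integral (a + 1))%E.
Proof.
move=> a0.
have := @ge0_integral_derive_sub R (fun n => n.+1%:R^-1) (fun n => n.+2%:R) _
  (fun t => t `^ a * expR (- t)) (fun t => a * (t `^ (a - 1) * expR (- t)))
  (fun t => t `^ a * expR (- t)) 0 0 itv0y_bigcup.
rewrite subrr add0e /gamma_integral addrK => IBP.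
apply: etrans; last apply: IBP => //.
- rewrite -ge0_integralZl//; last 3 first.
  + by apply/measurable_EFinP; exact: measurable_powR_expRN.
  + by move=> x _; rewrite lee_fin mulr_ge0 ?powR_ge0 ?expR_ge0.
  + by rewrite lee_fin ltW.
- by move=> n; rewrite (@le_lt_trans _ _ 1)// ?ltr1n// invf_le1// ler1n.
- by move=> m n mn; rewrite lef_pV2 ?posrE// ler_nat.
- by move=> m n mn; rewrite ler_nat !ltnS.
- by move=> x _; rewrite !mulr_ge0 ?powR_ge0 ?expR_ge0// ltW.
- by move=> x _; rewrite !mulr_ge0 ?powR_ge0 ?expR_ge0.
- move=> x /=; rewrite in_itv/= andbT => x0.
  apply: cvgM; first exact: cvg_cst.
  by apply: cvgM; [exact: continuous_powR_gt0|exact: continuous_expRN].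
- move=> x /=; rewrite in_itv/= andbT => x0.
  by apply: cvgM; [exact: continuous_powR_gt0|exact: continuous_expRN].
- move=> x /=; rewrite in_itv/= andbT => x0.
  have := is_derive1_powR a x0 => da.
  apply: is_derive_eq.
  rewrite /GRing.scale/=; ring.
- rewrite -(mulr0 (expR (- 0))).
  under eq_fun do rewrite mulrC.
  apply: cvgM.
    apply: (@cvg_comp _ _ _ (fun n => n.+1%:R^-1) (fun t : R => expR (- t)) \oo (nbhs 0)) => //.
      exact: cvg_harmonic.
    exact: continuous_expRN.
  by apply: cvg_powR0 => //; exact: cvg_harmonic.
- exact: cvg_powR_expRN.
Qed.

Lemma gamma_integral1 {R : realType} : gamma_integral (1 : R) = 1%E.
Proof.
have := @ge0_integral_derive_sub R (fun n => n.+1%:R^-1) (fun n => n.+2%:R) _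
  (fun t => - expR (- t)) (fun t => expR (- t)) (fun t => 0) (- expR (- 0)) (- 0) itv0y_bigcup.
rewrite integral0 adde0.
rewrite oppr0 expR0 sub0r opprK => IBP.
rewrite /gamma_integral subrr; under eq_integral do rewrite powRr0 mul1r.
apply: IBP => //.
- by move=> n; rewrite (@le_lt_trans _ _ 1)// ?ltr1n// invf_le1// ler1n.
- by move=> m n mn; rewrite lef_pV2 ?posrE// ler_nat.
- by move=> m n mn; rewrite ler_nat !ltnS.
- by move=> x _; exact: continuous_expRN.
- by move=> x _; exact: cvg_cst.
- move=> x /=; rewrite in_itv/= andbT => x0.
  apply: is_derive_eq.
  rewrite /GRing.scale/=; ring.
- have h : (fun n => n.+1%:R^-1 : R) n @[n --> \oo] --> (0:R) by exact: cvg_harmonic.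
  apply: cvgN.
  have := @cvg_comp _ _ _ (fun n => n.+1%:R^-1) (fun t : R => expR (- t)) \oo (nbhs 0) _ h (continuous_expRN 0).
  by rewrite oppr0 expR0.
- rewrite -oppr0; apply: cvgN.
  have := @cvg_powR_expRN R 0.
  by under eq_cvg do rewrite powRr0 mul1r.
Qed.

(** The functional equation gives Gamma (n + 1) = n!, hence finiteness at
    positive integers.  For b >= 1 the bound t^(b-1) <= 1 + t^m with an integer
    m >= b reduces to that case, and for a > 0 the equation
    a Gamma(a) = Gamma(a + 1) does. *)
Lemma gamma_integral_fin_num {R : realType} (a : R) : 0 < a ->
  gamma_integral a \is a fin_num.
Proof.
have I0 (b : R) : (0 <= gamma_integral b)%E.
  by apply: integral_ge0 => x _; rewrite lee_fin mulr_ge0 ?powR_ge0 ?expR_ge0.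
have In n : gamma_integral (n.+1%:R : R) \is a fin_num.
  elim: n => [|n IHn]; first by rewrite gamma_integral1.
  by rewrite -natr1 -gamma_integralD1// fin_numM.
have I1 (b : R) : 1 <= b -> gamma_integral b \is a fin_num.
  move=> b1; pose m := (Num.truncn b).+1.
  rewrite ge0_fin_numE//.
  apply: (@le_lt_trans _ _ (gamma_integral 1 + gamma_integral (m.+1%:R : R))%E); last first.
    by rewrite gamma_integral1 lte_add_pinfty// ?ltry// ltey_eq In.
  rewrite /gamma_integral -ge0_integralD//; last 4 first.
  - by move=> x _; rewrite lee_fin mulr_ge0 ?powR_ge0 ?expR_ge0.
  - by apply/measurable_EFinP; exact: measurable_powR_expRN.
  - by move=> x _; rewrite lee_fin mulr_ge0 ?powR_ge0 ?expR_ge0.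
  - by apply/measurable_EFinP; exact: measurable_powR_expRN.
  apply: ge0_le_integral => //.
  - by move=> x _; rewrite lee_fin mulr_ge0 ?powR_ge0 ?expR_ge0.
  - by apply/measurable_EFinP; exact: measurable_powR_expRN.
  - apply/measurable_EFinP; apply: measurable_funD; exact: measurable_powR_expRN.
  move=> x; rewrite /= in_itv/= andbT => x0.
  rewrite lee_fin -mulrDl ler_wpM2r ?expR_ge0// subrr powRr0.
  have x_ge0 := ltW x0.
  rewrite -natr1 addrK powR_mulrn//.
  have [x1|/ltW x1] := leP x 1.
    rewrite ler_wpDr ?exprn_ge0// -[leRHS](powRr0 x).
    by apply: ger_powR; rewrite ?x0 ?x1// subr_ge0.
  rewrite ler_wpDl// -powR_mulrn// ler_powR// /m.
  by rewrite lerBlDr ler_wpDr// ltW// truncnS_gt.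
move=> a0.
have : gamma_integral (a + 1) \is a fin_num by rewrite I1// lerDr ltW.
rewrite -gamma_integralD1// !ge0_fin_numE//; last by rewrite mule_ge0// lee_fin ltW.
by rewrite !ltey; apply: contra => /eqP ->; rewrite gt0_muley// lte_fin.
Qed.

Lemma Gamma_gt0 {R : realType} (a : R) : 0 < a -> 0 < Gamma a.
Proof.
move=> a0; rewrite GammaE fine_gt0// -ge0_fin_numE ?gamma_integral_fin_num//.
  rewrite andbT; apply: integral_gt0 => //.
  - by rewrite lebesgue_measure_itv/= ltry.
  - exact: measurable_powR_expRN.
  - by move=> x /=; rewrite in_itv/= andbT => x0; rewrite mulr_gt0 ?powR_gt0 ?expR_gt0.
by apply: integral_ge0 => x _; rewrite lee_fin mulr_ge0 ?powR_ge0 ?expR_ge0.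
Qed.

Lemma GammaD1 {R : realType} (a : R) : 0 < a -> Gamma (a + 1) = a * Gamma a.
Proof.
by move=> a0; rewrite !GammaE -gamma_integralD1// fineM// gamma_integral_fin_num.
Qed.

Lemma pochhammerE {R : realType} (a : R) (l : nat) : 0 < a ->
  pochhammer a l = rising a l.
Proof.
move=> a0; rewrite /pochhammer; apply/(canLR (mulfK _)).
  by rewrite gt_eqF// Gamma_gt0.
elim: l => [|l IHl]; first by rewrite addr0 /rising big_ord0 mul1r.
have al0 : 0 < a + l%:R by rewrite ltr_wpDr.
rewrite -natr1 addrA (GammaD1 _ al0) IHl risingS.
by move: (Gamma a) => g; rewrite mulrC mulrAC.
Qed.

(** * The beta function *)

(** The beta integral before truncation to a real number, as for
    [gamma_integral]. *)
Definition beta_integral {R : realType} (p q : R) : \bar R :=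
  \int[lebesgue_measure]_(x in `]0, 1[) (x `^ (p - 1) * (1 - x) `^ (q - 1))%:E.

Lemma rbeta_funE {R : realType} (p q : R) :
  rbeta_fun p q = fine (beta_integral p q).
Proof. by []. Qed.

Lemma measurable_beta_kernel {R : realType} (D : set R) (p q : R) :
  measurable_fun D (fun x : R => x `^ p * (1 - x) `^ q).
Proof.
apply: measurable_funTS; apply: measurable_funM; first exact: measurable_powR.
apply: (measurableT_comp (measurable_powR q)).
by apply: measurable_funB => //; exact: measurable_cst.
Qed.

Lemma beta_integral_ge0 {R : realType} (p q : R) : (0 <= beta_integral p q)%E.
Proof. by apply: integral_ge0 => x _; rewrite lee_fin mulr_ge0 ?powR_ge0. Qed.

Lemma beta_integralZl {R : realType} (c p q : R) : 0 < c ->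
  (c%:E * beta_integral p q = \int[lebesgue_measure]_(x in `]0%R, 1%R[)
    (c * (x `^ (p - 1) * (1 - x) `^ (q - 1)))%:E)%E.
Proof.
move=> c0; under [RHS]eq_integral do rewrite EFinM.
rewrite ge0_integralZl//.
- by apply/measurable_EFinP; exact: measurable_beta_kernel.
- by move=> x _; rewrite lee_fin mulr_ge0 ?powR_ge0.
- by rewrite lee_fin ltW.
Qed.

(** Integration by parts with the primitive x^p (1 - x)^q, which vanishes at 0
    and at 1. *)
Lemma beta_integral_parts {R : realType} (p q : R) : 0 < p -> 0 < q ->
  (p%:E * beta_integral p (q + 1) = q%:E * beta_integral (p + 1) q)%E.
Proof.
move=> p0 q0.
have inv_gt0 n : 0 < n.+3%:R^-1 :> R by rewrite invr_gt0.
have inv_lt2 n : n.+3%:R^-1 < 2^-1 :> R by rewrite ltf_pV2 ?posrE// ltr_nat.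
have inv_le m n : (m <= n)%N -> n.+3%:R^-1 <= m.+3%:R^-1 :> R.
  by move=> mn; rewrite lef_pV2 ?posrE// ler_nat.
have cvg_inv : (fun n => n.+3%:R^-1 : R) n @[n --> \oo] --> (0 : R).
  by have := @cvg_harmonic R; rewrite -(cvg_shiftn 2); under eq_cvg do rewrite /= addn2.
have c1B (s x : R) : x < 1 -> {for x, continuous (fun t : R => (1 - t) `^ s)}.
  move=> x1; apply: (@continuous_comp _ _ _ (fun t : R => 1 - t) (fun t : R => t `^ s)).
    by apply: cvgB; [exact: cvg_cst|exact: cvg_id].
  by apply: continuous_powR_gt0; rewrite subr_gt0.
have zero_at_end (s t : R) : 0 < s ->
    n.+3%:R^-1 `^ s * (1 - n.+3%:R^-1) `^ t @[n --> \oo] --> (0 : R).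
  move=> s0; rewrite -(mul0r ((1 - 0 : R) `^ t)).
  apply: cvgM; first exact: cvg_powR0.
  apply: (@cvg_comp _ _ _ (fun n => n.+3%:R^-1) (fun x : R => (1 - x) `^ t) \oo (nbhs 0)) => //.
  exact: c1B.
have := @ge0_integral_derive_sub R (fun n => n.+3%:R^-1) (fun n => 1 - n.+3%:R^-1) _
  (fun t => t `^ p * (1 - t) `^ q)
  (fun t => p * (t `^ (p - 1) * (1 - t) `^ q))
  (fun t => q * (t `^ p * (1 - t) `^ (q - 1))) 0 0 itv01_bigcup.
rewrite subrr add0e => IBP.
rewrite (beta_integralZl _ _ _ p0) (beta_integralZl _ _ _ q0) !addrK.
apply: IBP.
- move=> n; move: (inv_lt2 n); move: (n.+3%:R^-1) => e; lra.
- by move=> m n mn; exact: inv_le.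
- by move=> m n mn; rewrite lerB// inv_le.
- by move=> x _; rewrite !mulr_ge0 ?powR_ge0// ltW.
- by move=> x _; rewrite !mulr_ge0 ?powR_ge0// ltW.
- move=> x /=; rewrite in_itv/= => /andP[x0 x1].
  apply: cvgM; first exact: cvg_cst.
  by apply: cvgM; [exact: continuous_powR_gt0|exact: c1B].
- move=> x /=; rewrite in_itv/= => /andP[x0 x1].
  apply: cvgM; first exact: cvg_cst.
  by apply: cvgM; [exact: continuous_powR_gt0|exact: c1B].
- move=> x /=; rewrite in_itv/= => /andP[x0 x1].
  have dp := is_derive1_powR p x0.
  have : is_derive x 1 (fun t : R => (1 - t) `^ q) (- (q * (1 - x) `^ (q - 1))).
    have x1' : 0 < 1 - x by rewrite subr_gt0.
    have dq := is_derive1_powR q x1'.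
    have d1 : is_derive x 1 (fun t : R => 1 - t) (- 1) by apply: is_derive_eq; ring.
    have := @is_derive1_comp R (fun t => t `^ q) (fun t : R => 1 - t) x _ _ dq d1.
    by rewrite mulrN1.
  move=> dq.
  apply: is_derive_eq.
  rewrite /GRing.scale/=; ring.
- exact: zero_at_end.
- under eq_fun do rewrite subKr mulrC.
  exact: zero_at_end.
Qed.

(** Because 1 = x + (1 - x). *)
Lemma beta_integral_split {R : realType} (p q : R) :
  beta_integral p q = (beta_integral (p + 1) q + beta_integral p (q + 1))%E.
Proof.
rewrite /beta_integral -ge0_integralD//; last 4 first.
- by move=> x _; rewrite lee_fin mulr_ge0 ?powR_ge0.
- by apply/measurable_EFinP; exact: measurable_beta_kernel.
- by move=> x _; rewrite lee_fin mulr_ge0 ?powR_ge0.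
- by apply/measurable_EFinP; exact: measurable_beta_kernel.
apply: eq_integral => x; rewrite inE/= in_itv/= => /andP[x0 x1].
rewrite -EFinD; congr EFin.
have powR_succ (s y : R) : 0 < y -> y `^ (s + 1 - 1) = y * y `^ (s - 1).
  move=> y0; rewrite addrAC mulrC -{3}(powRr1 (ltW y0)) -powRD//.
  by rewrite (gt_eqF y0) implybT.
rewrite (powR_succ p x x0) (powR_succ q (1 - x)) ?subr_gt0//; ring.
Qed.

Lemma beta_integral_gt0 {R : realType} (p q : R) : (0 < beta_integral p q)%E.
Proof.
apply: integral_gt0 => //.
- by rewrite lebesgue_measure_itv/= lte_fin ltr01 oppr0 adde0 onee_neq0.
- exact: measurable_beta_kernel.
- by move=> x /=; rewrite in_itv/= => /andP[x0 x1]; rewrite mulr_gt0 ?powR_gt0// subr_gt0.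
Qed.

Lemma beta_integral_ge1_fin_num {R : realType} (p q : R) : 1 <= p -> 1 <= q ->
  beta_integral p q \is a fin_num.
Proof.
move=> p1 q1; rewrite ge0_fin_numE ?beta_integral_ge0//.
apply: (@le_lt_trans _ _ (\int[lebesgue_measure]_(x in `]0%R, 1%R[) 1%:E)%E).
  apply: ge0_le_integral => //.
  - by move=> x _; rewrite lee_fin mulr_ge0 ?powR_ge0.
  - by apply/measurable_EFinP; exact: measurable_beta_kernel.
  move=> x; rewrite /= in_itv/= => /andP[x0 x1].
  have le1 (y s : R) : 0 < y -> y < 1 -> 1 <= s -> y `^ (s - 1) <= 1.
    move=> y0 y1 s1; rewrite -[leRHS](powRr0 y).
    by apply: ger_powR; rewrite ?y0 ?(ltW y1)// subr_ge0.
  rewrite lee_fin mulr_ile1 ?powR_ge0// le1//.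
    by rewrite subr_gt0.
  by rewrite ltrBlDr ltrDl.
by rewrite integral_cst//= mul1e lebesgue_measure_itv/= lte_fin ltr01 oppr0 adde0 ltry.
Qed.

(** The integrand is bounded when both parameters are at least 1.  The two
    relations above bring the general case there: by [beta_integral_parts] the
    finiteness of B(p + 1, q) and of B(p, q + 1) are equivalent, and by
    [beta_integral_split] they imply that of B(p, q). *)
Lemma beta_integral_fin_num {R : realType} (p q : R) : 0 < p -> 0 < q ->
  beta_integral p q \is a fin_num.
Proof.
have fin_of_scale (c : R) (x : \bar R) : 0 < c -> (0 <= x)%E ->
    (c%:E * x)%E \is a fin_num -> x \is a fin_num.
  move=> c0 x0; rewrite !ge0_fin_numE//; last by rewrite mule_ge0// lee_fin ltW.
  by rewrite !ltey; apply: contra => /eqP ->; rewrite gt0_muley// lte_fin.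
have S_fin (s t : R) : 0 < s -> 0 < t -> beta_integral s (t + 1) \is a fin_num.
  move=> s0 t0.
  have B11 : beta_integral (s + 1) (t + 1) \is a fin_num.
    by apply: beta_integral_ge1_fin_num; rewrite lerDr ltW.
  rewrite (beta_integral_split s (t + 1)) fin_numD; apply/andP; split=> [//|].
  apply: (fin_of_scale s _ s0 (beta_integral_ge0 _ _)).
  by rewrite (beta_integral_parts s (t + 1) s0 (addr_gt0 t0 ltr01)) fin_numM.
move=> p0 q0; have B01 := S_fin p q p0 q0.
rewrite (beta_integral_split p q) fin_numD; apply/andP; split=> [|//].
apply: (fin_of_scale q _ q0 (beta_integral_ge0 _ _)).
by rewrite -(beta_integral_parts p q p0 q0) fin_numM.
Qed.

Lemma rbeta_fun_gt0 {R : realType} (p q : R) : 0 < p -> 0 < q -> 0 < rbeta_fun p q.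
Proof.
move=> p0 q0; rewrite rbeta_funE fine_gt0// beta_integral_gt0/=.
by rewrite -ge0_fin_numE ?beta_integral_ge0// beta_integral_fin_num.
Qed.

Lemma rbeta_fun_parts {R : realType} (p q : R) : 0 < p -> 0 < q ->
  p * rbeta_fun p (q + 1) = q * rbeta_fun (p + 1) q.
Proof.
move=> p0 q0.
have fin_num_p : beta_integral (p + 1) q \is a fin_num.
  exact: beta_integral_fin_num (addr_gt0 p0 ltr01) q0.
have fin_num_q : beta_integral p (q + 1) \is a fin_num.
  exact: beta_integral_fin_num p0 (addr_gt0 q0 ltr01).
rewrite !rbeta_funE; move: (beta_integral_parts p q p0 q0) fin_num_p fin_num_q.
by move: (beta_integral _ _) (beta_integral _ _) => [x| |] [y| |]//= [].
Qed.

Lemma rbeta_fun_split {R : realType} (p q : R) : 0 < p -> 0 < q ->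
  rbeta_fun p q = rbeta_fun (p + 1) q + rbeta_fun p (q + 1).
Proof.
move=> p0 q0; rewrite -[RHS]fineD -?beta_integral_split//.
- exact: beta_integral_fin_num (addr_gt0 p0 ltr01) q0.
- exact: beta_integral_fin_num p0 (addr_gt0 q0 ltr01).
Qed.

(** Solves the two relations [rbeta_fun_split] and [rbeta_fun_parts] for
    B(p + 1, q). *)
Lemma rbeta_funD1 {R : realType} (p q : R) : 0 < p -> 0 < q ->
  rbeta_fun (p + 1) q = p / (p + q) * rbeta_fun p q.
Proof.
move=> p0 q0; move: (rbeta_fun_split p q p0 q0) (rbeta_fun_parts p q p0 q0).
move: (rbeta_fun p q) (rbeta_fun (p + 1) q) (rbeta_fun p (q + 1)) => b bp bq -> parts.
have pq0 : p + q != 0 by rewrite (gt_eqF (addr_gt0 p0 q0)).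
by apply: (mulfI pq0); rewrite mulrA mulrCA divff// mulr1 mulrDr parts mulrDl.
Qed.

Lemma rbeta_fun_rising {R : realType} (p q : R) (r : nat) : 0 < p -> 0 < q ->
  rbeta_fun (p + r%:R) q / rbeta_fun p q = rising p r / rising (p + q) r.
Proof.
move=> p0 q0; elim: r => [|r IHr].
  by rewrite addr0 /rising !big_ord0 !divff ?gt_eqF// rbeta_fun_gt0.
rewrite -natr1 addrA rbeta_funD1 ?ltr_wpDr// -mulrA IHr !risingS addrAC.
have pr : 0 < p + q + r%:R by rewrite ltr_wpDr// addr_gt0.
have rr : 0 < rising (p + q) r by rewrite rising_gt0// addr_gt0.
by field; rewrite !gt_eqF.
Qed.

(** * Expectations and densities *)

(** The law of X is absolutely continuous because it has a density, and its
    Radon-Nikodym derivative agrees with f almost everywhere since both have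
    the same integral over every measurable set.  The function g may take
    negative values off D; replacing it there by 0 changes g(X) only on a null
    event, because the density vanishes off D. *)
Lemma expectation_pdf {d : measure_display} {T : measurableType d} {R : realType}
    {P : probability T R} {X : {RV P >-> R}} {f : R -> \bar R}
    (D : set R) (g : R -> R) :
  has_pdf X f -> measurable_fun setT f -> (forall x, 0 <= f x)%E ->
  measurable D -> (forall x, ~ D x -> f x = 0%E) ->
  measurable_fun setT g -> (forall x, D x -> 0 <= g x) ->
  ('E_P[g \o X] = \int[lebesgue_measure]_(x in D) ((g x)%:E * f x))%E.
Proof.
move=> hX mf f0 mD fD0 mg g0.
pose gD : R -> \bar R := (EFin \o g) \_ D.
have mgD : measurable_fun setT gD.
  apply/(measurable_restrictT _ mD)/measurable_funTS.
  by apply/measurable_EFinP.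
have gD0 x : (0 <= gD x)%E.
  by rewrite /gD patchE; case: ifPn => //; rewrite inE => Dx; rewrite lee_fin g0.
have mX : measurable_fun setT X by [].
have -> : ('E_P[g \o X] = \int[P]_w (gD \o X) w)%E.
  rewrite unlock; apply: ae_eq_integral => //.
  - by apply/measurable_EFinP; exact: measurableT_comp.
  - exact: measurableT_comp.
  exists (X @^-1` (~` D)); split.
  - by rewrite -[X in measurable X]setTI; apply: mX => //; exact: measurableC.
  - transitivity (distribution P X (~` D)) => //.
    rewrite hX; last exact: measurableC.
    by apply: integral0_eq => x Dx; exact: fD0.
  - move=> w /=; apply: contra_not => Dx _.
    by rewrite /gD patchE mem_set.
(* The Lebesgue measure lives on another copy of the Borel structure of R, to
   which X has to be transported. *)
have mXB : @measurable_fun _ _ T (measurableTypeR R) setT X by [].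
pose XB := @mfun_Sub _ _ T (measurableTypeR R) X (mem_set mXB).
pose nu : {finite_measure set (measurableTypeR R) -> \bar R} := distribution P XB.
transitivity (\int[nu]_x gD x)%E.
  by rewrite /nu ge0_integral_distribution.
pose mu : {sigma_finite_measure set (measurableTypeR R) -> \bar R} :=
  lebesgue_measure.
have nuf A : measurable A -> nu A = (\int[mu]_(x in A) f x)%E by exact: hX.
have dom : nu `<< mu.
  apply/null_content_dominatesP => A mA A0.
  by rewrite nuf// null_set_integral//; exact: measurable_funTS.
rewrite -(Radon_Nikodym_SigmaFinite.change_of_variables dom)//.
transitivity (\int[mu]_x (gD x * f x))%E; last first.
  rewrite [RHS]integral_mkcond; apply: eq_integral => x _.
  by rewrite /gD !patchE; case: ifPn => //; rewrite mul0e.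
apply: ae_eq_integral => //.
- apply: emeasurable_funM => //.
  exact: measurable_int (Radon_Nikodym_SigmaFinite.f_integrable dom).
- exact: emeasurable_funM.
- apply: ae_eqe_mul2l.
  apply: integral_ae_eq => //.
  + exact: Radon_Nikodym_SigmaFinite.f_integrable.
  + by move=> E _ mE; rewrite -Radon_Nikodym_SigmaFinite.f_integral// nuf.
Qed.

(** * Resummation into Kummer functions *)

(** Separates the summation variable j from the indices of the final formula:
    the numerator is expanded by [rising_Vandermonde], and the denominator is
    rewritten by computing (b)_(j + r) in two ways. *)
Lemma rising_ratioE {R : numFieldType} (a b : R) (j r : nat) : 0 < a -> 0 < b ->
  rising (a + j%:R) r / rising (b + j%:R) r =
  rising a r / rising b r * \sum_(0 <= i < r.+1)
    ('C(r, i)%:R / rising a i * ((j ^_ i)%:R * (rising b j / rising (b + r%:R) j))).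
Proof.
move=> a0 b0.
have rising_neq0 (x : R) n : 0 < x -> rising x n != 0.
  by move=> x0; rewrite gt_eqF// rising_gt0.
have -> : (rising (b + j%:R) r)^-1 = rising b j / rising (b + r%:R) j / rising b r.
  have jr : rising b j * rising (b + j%:R) r = rising b r * rising (b + r%:R) j.
    by rewrite -!risingD addnC.
  transitivity (rising b j / (rising b j * rising (b + j%:R) r)).
    by field; rewrite !rising_neq0// ltr_wpDr.
  by rewrite jr; field; rewrite !rising_neq0// ltr_wpDr.
rewrite rising_Vandermonde.
rewrite mulr_suml [in RHS]mulr_sumr; apply: eq_big_nat => i /andP[_]; rewrite ltnS => ir.
have -> : rising a r = rising a i * rising (a + i%:R) (r - i).
  by rewrite -risingD subnKC.
by rewrite natrM; field; rewrite !rising_neq0// ltr_wpDr.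
Qed.

(** For a <= b the coefficients (a)_i / (b)_i are at most 1, so the series is
    dominated by that of the exponential. *)
Lemma cvg_kummer {R : realType} (a b z : R) : 0 < a -> a <= b -> 0 <= z ->
  series (fun i : nat => rising a i / rising b i * (z ^+ i / i`!%:R)) n @[n --> \oo]
    --> kummer a b z.
Proof.
move=> a0 ab z0; have b0 := lt_le_trans a0 ab.
rewrite /kummer; under [X in limn (series X)]eq_fun do rewrite !pochhammerE//.
have coeff_ge0 i : 0 <= z ^+ i / i`!%:R by rewrite divr_ge0 ?exprn_ge0.
apply: (@series_le_cvg _ _ (exp_coeff z)) => [i|i|i|].
- by rewrite mulr_ge0// divr_ge0// ltW// rising_gt0.
- exact: coeff_ge0.
- rewrite /exp_coeff ler_piMl// ler_pdivrMr ?rising_gt0// mul1r.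
  by apply: ler_prod => k _; rewrite lerD2r ab andbT addr_ge0// ltW.
- exact: is_cvg_series_exp_coeff.
Qed.

(** The terms with j < i vanish; for j = i + k the falling factorial cancels
    against j! and leaves k!, which gives a Kummer series in k with both
    parameters shifted by i. *)
Lemma cvg_series_ffact {R : realType} (a b z : R) (i : nat) :
  0 < a -> a <= b -> 0 <= z ->
  series (fun j : nat => (j ^_ i)%:R * (rising a j / rising b j) * (z ^+ j / j`!%:R)) n
    @[n --> \oo] -->
  rising a i / rising b i * z ^+ i * kummer (a + i%:R) (b + i%:R) z.
Proof.
move=> a0 ab z0; rewrite -(cvg_shiftn i).
have -> : [sequence series (fun j : nat =>
      (j ^_ i)%:R * (rising a j / rising b j) * (z ^+ j / j`!%:R)) (n + i)%N]_n =
    (fun n => rising a i / rising b i * z ^+ i * series (fun k : nat =>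
      rising (a + i%:R) k / rising (b + i%:R) k * (z ^+ k / k`!%:R)) n).
  apply/funext => n; rewrite /series/= (big_cat_nat _ (n := i))//= ?leq_addl//.
  rewrite big_nat_cond big1 ?add0r; last first.
    by move=> j /andP[/andP[_ ji] _]; rewrite ffact_small// !mul0r.
  rewrite -{1}[i]add0n big_addn addnK big_distrr/=; apply: eq_bigr => k _.
  rewrite [(k + i)%N]addnC !risingD exprD.
  rewrite -(ffact_fact (leq_addr k i)) addKn natrM.
  have f0 : ((i + k) ^_ i)%:R != 0 :> R.
    by rewrite pnatr_eq0 -lt0n ffact_gt0 leq_addr.
  have k0 : k`!%:R != 0 :> R by rewrite pnatr_eq0 -lt0n fact_gt0.
  have b0 := lt_le_trans a0 ab.
  have bi : rising b i != 0 by rewrite gt_eqF// rising_gt0.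
  have bk : rising (b + i%:R) k != 0 by rewrite gt_eqF// rising_gt0// ltr_wpDr.
  by field; rewrite bi bk k0 f0.
by apply: cvgMr; apply: cvg_kummer; rewrite ?ltr_wpDr ?lerD2r.
Qed.

Lemma cvg_series_rising_ratio {R : realType} (a b z : R) (r : nat) :
  0 < a -> 0 < b -> 0 <= z ->
  series (fun j : nat =>
    z ^+ j / j`!%:R * (rising (a + j%:R) r / rising (b + j%:R) r)) n @[n --> \oo] -->
  rising a r / rising b r * \sum_(0 <= i < r.+1)
    ('C(r, i)%:R * rising b i * z ^+ i) / (rising a i * rising (b + r%:R) i) *
    kummer (b + i%:R) (b + r%:R + i%:R) z.
Proof.
move=> a0 b0 z0.
have -> : series (fun j : nat =>
      z ^+ j / j`!%:R * (rising (a + j%:R) r / rising (b + j%:R) r)) =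
    (fun n => rising a r / rising b r * \sum_(0 <= i < r.+1) 'C(r, i)%:R / rising a i *
      series (fun j : nat => (j ^_ i)%:R * (rising b j / rising (b + r%:R) j) *
        (z ^+ j / j`!%:R)) n).
  apply/funext => n; rewrite /series/=.
  under eq_bigr do rewrite rising_ratioE// mulrCA mulr_sumr.
  rewrite -mulr_sumr exchange_big/=; congr (_ * _); apply: eq_bigr => i _.
  by rewrite mulr_sumr; apply: eq_bigr => j _; ring.
apply: cvgMr.
apply: cvg_big => [|i _]; first exact: add_continuous.
have -> : 'C(r, i)%:R * rising b i * z ^+ i / (rising a i * rising (b + r%:R) i) *
    kummer (b + i%:R) (b + r%:R + i%:R) z =
  'C(r, i)%:R / rising a i * (rising b i / rising (b + r%:R) i * z ^+ i *
    kummer (b + i%:R) (b + r%:R + i%:R) z).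
  by rewrite invfM; ring.
by apply: cvgMr; apply: cvg_series_ffact; rewrite ?lerDl.
Qed.

(** * Moments of the two beta distributions *)

Lemma rbeta_pdf_ge0 {R : realType} (p q x : R) : 0 < p -> 0 < q -> 0 <= rbeta_pdf p q x.
Proof.
move=> p0 q0; rewrite /rbeta_pdf patchE; case: ifPn => // _.
by rewrite divr_ge0 ?mulr_ge0 ?powR_ge0// ltW// rbeta_fun_gt0.
Qed.

Lemma measurable_rbeta_pdf {R : realType} (p q : R) :
  measurable_fun [set: R] (rbeta_pdf p q).
Proof.
apply/(measurable_restrictT _ (measurable_itv _)).
apply: measurable_funM; first exact: measurable_beta_kernel.
exact: measurable_cst.
Qed.

(** Multiplying the density by x^r shifts the first parameter of the beta
    integral by r. *)
Lemma rbeta_moment {R : realType} (p q : R) (r : nat) : 0 < p -> 0 < q ->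
  (\int[lebesgue_measure]_(x in `]0%R, 1%R[) ((x ^+ r)%:E * (rbeta_pdf p q x)%:E) =
   (rising p r / rising (p + q) r)%:E)%E.
Proof.
move=> p0 q0; have pr0 : 0 < p + r%:R by rewrite ltr_wpDr.
have B0 := rbeta_fun_gt0 p q p0 q0.
rewrite -rbeta_fun_rising// EFinM.
rewrite (rbeta_funE (p + r%:R)) (fineK (beta_integral_fin_num _ _ pr0 q0)) muleC.
have Binv : 0 < (rbeta_fun p q)^-1 by rewrite invr_gt0.
rewrite (beta_integralZl _ _ _ Binv).
apply: eq_integral => x x01; rewrite -EFinM; congr EFin.
rewrite /rbeta_pdf patchE x01 /= [RHS]mulrC !mulrA; congr (_ / _).
congr (_ * _); move: x01; rewrite inE/= in_itv/= => /andP[x0 _].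
rewrite -(powR_mulrn r (ltW x0)) -powRD; last by rewrite (gt_eqF x0) implybT.
by rewrite addrAC [in RHS]addrC.
Qed.

Definition poisson_weight {R : realType} (z : R) (j : nat) : R :=
  expR (- z) * (z ^+ j / j`!%:R).

Lemma poisson_weight_ge0 {R : realType} (z : R) (j : nat) :
  0 <= z -> 0 <= poisson_weight z j.
Proof. by move=> z0; rewrite mulr_ge0 ?expR_ge0// divr_ge0 ?exprn_ge0. Qed.

Lemma ncb1_pdf_ge0 {R : realType} (a1 a2 lam x : R) :
  0 < a1 -> 0 < a2 -> 0 <= lam -> (0 <= ncb1_pdf a1 a2 lam x)%E.
Proof.
move=> a10 a20 lam0; apply: nneseries_ge0 => j _ _; rewrite lee_fin.
apply: mulr_ge0; first by apply: poisson_weight_ge0; rewrite divr_ge0.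
by rewrite rbeta_pdf_ge0// ltr_wpDr.
Qed.

Lemma measurable_ncb1_pdf {R : realType} (a1 a2 lam : R) :
  0 < a1 -> 0 < a2 -> 0 <= lam -> measurable_fun [set: R] (ncb1_pdf a1 a2 lam).
Proof.
move=> a10 a20 lam0; apply: (@ge0_emeasurable_sum _ _ _ _ (fun j x =>
  (poisson_weight (lam / 2) j * rbeta_pdf (a1 + j%:R) a2 x)%:E) xpredT).
  move=> j x _ _; rewrite lee_fin; apply: mulr_ge0.
    by apply: poisson_weight_ge0; rewrite divr_ge0.
  by rewrite rbeta_pdf_ge0// ltr_wpDr.
move=> j _; apply/measurable_EFinP; apply: measurable_funM.
  exact: measurable_cst.
exact: measurable_rbeta_pdf.
Qed.

Lemma ncb1_pdf_out {R : realType} (a1 a2 lam x : R) :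
  ~ `]0, 1[%classic x -> ncb1_pdf a1 a2 lam x = 0%E.
Proof.
move=> x01; rewrite /ncb1_pdf eseries0// => j _ _.
by rewrite /rbeta_pdf patchE memNset// mulr0.
Qed.

(** All terms are nonnegative, so sum and integral can be exchanged; what
    remains is a Poisson mixture of the moments of beta distributions. *)
Lemma ncb1_moment {R : realType} (a1 a2 lam : R) (r : nat) :
  0 < a1 -> 0 < a2 -> 0 <= lam ->
  (\int[lebesgue_measure]_(x in `]0%R, 1%R[)
     ((x ^+ r)%:E * ncb1_pdf a1 a2 lam x) =
   \sum_(0 <= j <oo) (poisson_weight (lam / 2) j *
     (rising (a1 + j%:R) r / rising (a1 + a2 + j%:R) r))%:E)%E.
Proof.
move=> a10 a20 lam0.
have w0 j : 0 <= poisson_weight (lam / 2) j by rewrite poisson_weight_ge0 ?divr_ge0.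
have aj j : 0 < a1 + j%:R by rewrite ltr_wpDr.
have exp_ge0 (x : R) : `]0, 1[%classic x -> 0 <= x ^+ r.
  by rewrite /= in_itv/= => /andP[/ltW x0 _]; rewrite exprn_ge0.
have xpdf_ge0 j x : `]0, 1[%classic x ->
    (0 <= (x ^+ r)%:E * (rbeta_pdf (a1 + j%:R) a2 x)%:E)%E.
  by move=> x01; rewrite mule_ge0 ?lee_fin ?exp_ge0 ?rbeta_pdf_ge0.
have mxpdf j : measurable_fun (`]0, 1[%classic : set R) (fun x =>
    (x ^+ r)%:E * (rbeta_pdf (a1 + j%:R) a2 x)%:E)%E.
  apply/measurable_funTS/measurable_EFinP; apply: measurable_funM.
    exact: measurable_funX.
  exact: measurable_rbeta_pdf.
transitivity (\int[lebesgue_measure]_(x in `]0%R, 1%R[)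
    \sum_(0 <= j <oo) ((poisson_weight (lam / 2) j)%:E *
      ((x ^+ r)%:E * (rbeta_pdf (a1 + j%:R) a2 x)%:E)))%E.
  apply: eq_integral => x _; rewrite /ncb1_pdf -nneseriesZl; last first.
    by move=> j _; rewrite lee_fin; apply: mulr_ge0 (w0 j) _; rewrite rbeta_pdf_ge0.
  by apply: eq_eseriesr => j _; rewrite EFinM muleCA.
rewrite integral_nneseries//; last 2 first.
- by move=> j; apply: emeasurable_funM => //; exact: mxpdf.
- by move=> j x x01; apply: mule_ge0; [rewrite lee_fin|exact: xpdf_ge0].
apply: eq_eseriesr => j _.
rewrite [RHS]EFinM (addrAC a1 a2) -(rbeta_moment _ _ r (aj j) a20).
rewrite ge0_integralZl//.
- exact: mxpdf.
- by move=> x x01; exact: xpdf_ge0.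
- by rewrite lee_fin.
Qed.

Theorem proposition4p5 (R : realType) (a1 a2 lam : R)
    (ha1 : 0 < a1) (ha2 : 0 < a2) (hlam : 0 <= lam)
    (d : measure_display) (T : measurableType d) (P : probability T R)
    (X : {RV P >-> R}) (hX : has_pdf X (ncb1_pdf a1 a2 lam))
    (r : nat) (hr : (1 <= r)%N) :
  ('E_P[fun t => (X t ^+ r)%R] =
    (pochhammer a1 r / pochhammer (a1 + a2) r * expR (- (lam / 2)) *
     \sum_(0 <= i < r.+1)
        ('C(r, i)%:R * pochhammer (a1 + a2) i * (lam / 2) ^+ i) /
        (pochhammer a1 i * pochhammer (a1 + a2 + r%:R) i) *
        kummer (a1 + a2 + i%:R) (a1 + a2 + r%:R + i%:R) (lam / 2))%:E)%E
  /\
  (forall (d' : measure_display) (T' : measurableType d')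
      (Q : probability T' R) (Y : {RV Q >-> R}),
    has_pdf Y (fun x : R => (rbeta_pdf a1 a2 x)%:E) ->
    ('E_Q[fun t => (Y t ^+ r)%R] =
      (pochhammer a1 r / pochhammer (a1 + a2) r)%:E)%E).
Proof.
have a12 : 0 < a1 + a2 by rewrite addr_gt0.
have a12r : 0 < a1 + a2 + r%:R by rewrite ltr_wpDr.
have mexp : measurable_fun [set: R] (fun x : R => x ^+ r) by exact: measurable_funX.
have exp_ge0 (x : R) : `]0, 1[%classic x -> 0 <= x ^+ r.
  by rewrite /= in_itv/= => /andP[/ltW x0 _]; rewrite exprn_ge0.
split; last first.
  move=> d' T' Q Y hY; rewrite !pochhammerE//.
  rewrite (expectation_pdf `]0, 1[%classic (fun x => x ^+ r) hY)//.
  - exact: rbeta_moment.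
  - by apply/measurable_EFinP; exact: measurable_rbeta_pdf.
  - by move=> x; rewrite lee_fin rbeta_pdf_ge0.
  - by move=> x x01; rewrite /rbeta_pdf patchE memNset.
rewrite (expectation_pdf `]0, 1[%classic (fun x => x ^+ r) hX)//; last 3 first.
- exact: measurable_ncb1_pdf.
- by move=> x; exact: ncb1_pdf_ge0.
- by move=> x; exact: ncb1_pdf_out.
rewrite ncb1_moment//; apply/cvg_lim => //.
rewrite !pochhammerE// [_ * expR _]mulrC -mulrA.
under eq_bigr do rewrite !pochhammerE//.
apply: cvg_EFin; first by apply: nearW => n; rewrite sumEFin.
rewrite (_ : _ \o _ = fun n => expR (- (lam / 2)) * series (fun j =>
  (lam / 2) ^+ j / j`!%:R *
  (rising (a1 + j%:R) r / rising (a1 + a2 + j%:R) r)) n); last first.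
  apply/funext => n /=; rewrite sumEFin/= /series/= mulr_sumr.
  by apply: eq_bigr => j _; rewrite [RHS]mulrA.
by apply: cvgMr; apply: cvg_series_rising_ratio; rewrite ?divr_ge0.
Qed.
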